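(* Assume that $\mathrm{MA(countable)}$ holds. Then there exists a non-principal ultrafilter $\mathcal{U}\subseteq 2^\omega$ on $\omega$ such that every closed subset of $\mathcal{U}$, regarded as a subset of $2^\omega$, has the perfect set property.
   Context: Every subset of $\omega$ is identified with its characteristic function, so an ultrafilter on $\omega$ is regarded as a subset of the Cantor set $2^\omega$ and carries the subspace topology; ''closed subset of $\mathcal{U}$'' means closed in this subspace topology. A perfect set in $2^\omega$ is a non-empty closed subset of $2^\omega$ with no isolated points (equivalently, a subset homeomorphic to $2^\omega$). A set $A\subseteq 2^\omega$ has the perfect set property if $A$ is either countable or contains a perfect set in $2^\omega$. $\mathrm{MA(countable)}$ (Martin's Axiom for countable posets) is the statement: for every non-empty countable partially ordered set $\mathbb{P}$ and every collection $\mathcal{D}$ of dense subsets of $\mathbb{P}$ with $|\mathcal{D}|<\mathfrak{c}=2^{\aleph_0}$, there is a filter $G\subseteq\mathbb{P}$ that meets every element of $\mathcal{D}$. *)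

(* Defs.v *)
From mathcomp Require Import all_boot all_order.
From mathcomp Require Import boolp classical_sets functions cardinality filter.
From mathcomp Require Import topology cantor.

Set Implicit Arguments.
Unset Strict Implicit.
Unset Printing Implicit Defensive.

Import Order.TTheory.

Local Open Scope classical_set_scope.
Local Open Scope card_scope.

Definition char_fun (A : set nat) : cantor_space := fun n => n \in A.

Definition char_family (U : set_system nat) : set cantor_space :=
  char_fun @` U.

(* [subspace X] has the whole type as carrier, hence the inclusion [A `<=` X]. *)
Definition closed_subset_of {T : topologicalType} (X A : set T) : Prop :=
  A `<=` X /\ closed (A : set (subspace X)).

(* [perfect_set] also holds of the empty set. *)
Definition perfect_set_property (A : set cantor_space) : Prop :=
  countable A \/
  exists P : set cantor_space, [/\ perfect_set P, P !=set0 & P `<=` A].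

Definition order_dense {d : Order.disp_t} {P : porderType d} (D : set P) : Prop :=
  forall p : P, exists2 q : P, D q & (q <= p)%O.

(* Filters in the sense of forcing: smaller conditions are stronger. *)
Definition order_filter {d : Order.disp_t} {P : porderType d} (G : set P) : Prop :=
  [/\ G !=set0,
      forall p q : P, G p -> (p <= q)%O -> G q &
      forall p q : P, G p -> G q -> exists r : P, [/\ G r, (r <= p)%O & (r <= q)%O]].

(* The continuum is the cardinal of [cantor_space]. *)
Definition card_lt_continuum {T : Type} (A : set T) : Prop :=
  A #<= [set: cantor_space] /\ A #!= [set: cantor_space].

Definition MA_countable : Prop :=
  forall (d : Order.disp_t) (P : porderType d),
    [set: P] !=set0 -> countable [set: P] ->
    forall D : set (set P),
      (forall E, D E -> order_dense E) -> card_lt_continuum D ->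
      exists2 G : set P, order_filter G & forall E, D E -> G `&` E !=set0.

Definition nonprincipal_ultrafilter (U : set_system nat) : Prop :=
  UltraFilter U /\ forall n : nat, U <> principal_filter n.

(* Main.v *)
Require Import Defs.
From HB Require Import structures.
From mathcomp Require Import all_boot all_order finmap.
From mathcomp Require Import boolp classical_sets functions cardinality filter.
From mathcomp Require Import wochoice topology cantor.

(** The idea is to make the ultrafilter $U$ satisfy the following property:
    every sequence $Q$ of members of $U$ whose range has no isolated point has
    a non-empty subset of its range, again without isolated points, all of
    whose elements contain one and the same $z \in U$ ([traps z Q]).

    This suffices.  Let $A$ be an uncountable closed subset of $U$.  Its
    condensation points contain a countable set without isolated points
    ([uncountable_crowded]); let $C$ be the part of it trapped by $z \in U$.
    The closure of $C$ in the Cantor space is perfect ([perfect_closure]).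
    The condition that $x$ contains $z$ is closed, so every point of the
    closure contains $z$ and hence belongs to $U$; as $A$ is closed in $U$,
    the whole closure lies in $A$.

    To obtain $U$, list all sequences $Q_x$ along a well-order of the
    continuum all of whose proper initial segments are smaller than the
    continuum ([wf_initial_segments]), and choose sets $z_x$ recursively so
    that all the $z_x$ together with the final segments of $\omega$ have the
    finite intersection property.  At stage $x$, if the earlier $z_y$ are
    compatible with the terms of $Q_x$, choose $z_x$ trapping $Q_x$;
    otherwise no ultrafilter containing the $z_y$ contains all terms of $Q_x$
    and there is nothing to do ([trapping_family]).  Any ultrafilter
    containing the final segments and all the $z_x$ is then as required.

    MA(countable) enters in the successor step ([generic_trap]).  A condition
    consists of finitely many terms of $Q$ and a bound $n$ below which the
    intersection of the chosen terms may no longer shrink.  A generic filter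
    produces in the limit a set $z$ with trapped terms accumulating at each
    other, and a density argument for each finite intersection of earlier
    sets keeps $z$ compatible with them.  Apart from countably
    many, the dense sets are indexed by these finite intersections, and their
    number stays below the continuum because an infinite set has as many
    finite subsets as elements; this rests on
    $\kappa \cdot \kappa = \kappa$ ([card_setXX_le]). *)

Set Implicit Arguments.
Unset Strict Implicit.
Unset Printing Implicit Defensive.

Local Open Scope classical_set_scope.
Local Open Scope card_scope.

(** * Cardinal arithmetic *)

Section CardinalArithmetic.
Implicit Types T U V : pointedType.

Lemma card_le_funP (T : Type) U (A : set T) (B : set U) :
  A #<= B <-> exists2 f : T -> U, set_fun A B f & set_inj A f.
Proof. by split=> [/pcard_leP/injfunPex|/injfunPex/pcard_leP]. Qed.

Lemma card_le_rel (T : Type) U (A : set T) (B : set U) (R : T -> U -> Prop) :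
  (forall a, A a -> exists2 b, B b & R a b) ->
  (forall a a' b, R a b -> R a' b -> a = a') -> A #<= B.
Proof.
move=> tot inj; apply/card_le_funP.
pose f a := xget point [set b | B b /\ R a b].
have fP a : A a -> B (f a) /\ R a (f a).
  by move=> /tot[b Bb Rab]; rewrite /f; case: xgetP => [x -> //|/(_ b)[]].
exists f => [a /fP[]//|a a' /set_mem/fP[_ Ra] /set_mem/fP[_ Ra'] e].
by apply: (inj _ _ (f a)) => //; rewrite e.
Qed.

(** A maximal partial injection from [A] to [B] exhausts one of the two. *)
Lemma card_le_total T U (A : set T) (B : set U) : A #<= B \/ B #<= A.
Proof.
pose P (G : set (T * U)) :=
  [/\ forall a b, G (a, b) -> A a /\ B b,
      forall a b b', G (a, b) -> G (a, b') -> b = b' &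
      forall a a' b, G (a, b) -> G (a', b) -> a = a'].
have [F FP tF|G [[GAB Gf Gi] Gmax]] := @Zorn_bigcup _ P.
  split=> [a b [X FX Xab]|a b b' [X FX Xab] [Y FY Yab]|
    a a' b [X FX Xab] [Y FY Yab]].
  - by have [+ _ _] := FP X FX; apply.
  - have [XY|YX] := tF X Y FX FY.
      by have [_ + _] := FP Y FY; apply; [apply: XY Xab|].
    by have [_ + _] := FP X FX; apply; [apply: Xab|apply: YX].
  - have [XY|YX] := tF X Y FX FY.
      by have [_ _ +] := FP Y FY; apply; [apply: XY Xab|].
    by have [_ _ +] := FP X FX; apply; [apply: Xab|apply: YX].
have [AG|/existsNP[a /not_implyP[Aa Ga]]] :=
    pselect (forall a, A a -> exists b, G (a, b)).
  left; apply: (@card_le_rel _ _ _ _ (fun a b => G (a, b))) => //.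
  by move=> a /AG[b Gab]; exists b => //; have [] := GAB _ _ Gab.
have [BG|/existsNP[b /not_implyP[Bb Gb]]] :=
    pselect (forall b, B b -> exists a, G (a, b)).
  right; apply: (@card_le_rel _ _ _ _ (fun b a => G (a, b))).
    by move=> b /BG[a' Gab]; exists a' => //; have [] := GAB _ _ Gab.
  by move=> ? ? ?; apply: Gf.
exfalso; apply: (Gmax (G `|` [set (a, b)])).
  split=> [x Gx|sub]; first by left.
  by apply: Ga; exists b; apply: sub; right.
split=> [x y [/GAB//|[-> ->]]//|x y y' [Gxy|[xa yb]] [Gxy'|[xa' yb']]|
  x x' y [Gxy|[xa yb]] [Gxy'|[xa' yb']]]; subst=> //.
- exact: Gf Gxy Gxy'.
- by case: Ga; exists y.
- by case: Ga; exists y'.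
- exact: Gi Gxy Gxy'.
- by case: Gb; exists x.
- by case: Gb; exists x'.
Qed.

Lemma card_leX T T' U U' (A : set T) (A' : set T') (B : set U) (B' : set U') :
  A #<= A' -> B #<= B' -> A `*` B #<= A' `*` B'.
Proof.
move=> /card_le_funP[f fA finj] /card_le_funP[g gB ginj].
apply/card_le_funP; exists (fun x => (f x.1, g x.2)).
  by move=> [a b] [/= Aa Bb]; split; [apply: fA|apply: gB].
move=> [a b] [a' b'] /set_mem[/= Aa Bb] /set_mem[/= Aa' Bb'] [ff gg].
by congr pair; [apply: finj|apply: ginj] => //; exact/mem_set.
Qed.

(** Two distinct points of [X] serve as tags for the two summands. *)
Lemma card_leU T U (A B : set T) (X : set U) : infinite_set X ->
  X `*` X #<= X -> A #<= X -> B #<= X -> A `|` B #<= X.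
Proof.
move=> Xoo XX AX BX; have /card_le_funP[n nX ninj] := (infiniteP X).1 Xoo.
apply: card_le_trans XX.
move: AX BX => /card_le_funP[f fA finj] /card_le_funP[g gB ginj].
apply: (@card_le_rel _ _ _ _ (fun x p =>
   (A x /\ p = (n 0, f x)) \/ (B x /\ p = (n 1, g x)))) => [x [Ax|Bx]|].
- by exists (n 0, f x); [split; [exact: nX|exact: fA]|left].
- by exists (n 1, g x); [split; [exact: nX|exact: gB]|right].
have n01 : n 0 <> n 1 by move=> /ninj; rewrite !in_setT => /(_ isT isT).
move=> x y _ [[Ax ->]|[Bx ->]] [[Ay [//]]|[By [//]]].
- by move=> e; apply: finj => //; exact/mem_set.
- by move=> /esym.
- by move=> e; apply: ginj => //; exact/mem_set.
Qed.

(** Zorn's lemma is applied to the injective relations, possibly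
    multi-valued, that send every pair in [X `*` X] into [X], with [X] an
    infinite subset of [A].  For a maximal one, the rest [A `\` X] cannot be as
    large as [X]: otherwise it contains a copy [Y] of [X], and the relation
    extends to [X `|` Y], the new pairs being sent to [Y].  So [A `\` X], and
    with it [A], is no larger than [X].  The set [X] is read off from the
    diagonal of the relation, and the empty relation is admitted as the union
    of the empty chain. *)
Lemma card_setXX_le T (A : set T) : infinite_set A -> A `*` A #<= A.
Proof.
move=> Aoo.
pose dom (G : set ((T * T) * T)) : set T := [set x | exists z, G ((x, x), z)].
pose P (G : set ((T * T) * T)) :=
  [/\ forall x y z, G ((x, y), z) -> [/\ dom G x, dom G y, dom G z & A x],
      forall x y, dom G x -> dom G y -> exists z, G ((x, y), z),
      forall p p' z, G (p, z) -> G (p', z) -> p = p' &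
      G = set0 \/ infinite_set (dom G)].
have domS G H : G `<=` H -> dom G `<=` dom H by move=> GH x [z /GH]; exists z.
have [F FP tF|G [[Gd Gt Gi Goo] Gmax]] := @Zorn_bigcup _ P.
  split.
  - move=> x y z [X FX Xxy]; have [+ _ _ _] := FP X FX.
    move=> /(_ _ _ _ Xxy)[? ? ? ?].
    by split=> //; apply: (domS X) => //; exact: bigcup_sup.
  - move=> x y [z [X FX Xx]] [w [Y FY Yy]].
    have [XY|YX] := tF X Y FX FY.
      have [_ + _ _] := FP Y FY => /(_ x y).
      by case=> [||u Yu]; [exists z; exact: XY|exists w|exists u, Y].
    have [_ + _ _] := FP X FX => /(_ x y).
    by case=> [||u Xu]; [exists z|exists w; exact: YX|exists u, X].
  - move=> p p' z [X FX Xxy] [Y FY Yxy]; have [XY|YX] := tF X Y FX FY.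
      by have [_ _ + _] := FP Y FY; apply; [apply: XY Xxy|].
    by have [_ _ + _] := FP X FX; apply; [apply: Xxy|apply: YX].
  - have [F0|/existsNP[X /not_implyP[FX X0]]] :=
      pselect (forall X, F X -> X = set0).
      by left; rewrite bigcup0.
    right; have [_ _ _ [//|]] := FP X FX.
    by apply: sub_infinite_set; apply: domS; exact: bigcup_sup.
have ext H : P H -> G `<=` H -> H `<=` G.
  by move=> PH GH; apply: contrapT => HG; exact: (Gmax H).
have domA : dom G `<=` A by move=> x [z /Gd[]].

(* the empty graph is not maximal: a countably infinite part of A extends it *)
have [G0|Xoo] := Goo.
  have /card_le_funP[n nA ninj] := (infiniteP A).1 Aoo.
  have {}ninj i j : n i = n j -> i = j by apply: ninj; rewrite in_setT.
  pose H : set ((T * T) * T) :=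
    [set p | exists i j, p = ((n i, n j), n (choice.pickle (i, j)))].
  have domH : dom H = range n.
    apply/seteqP; split=> [x [z [i [j [-> _ _]]]]|_ [i _ <-]].
      by exists i.
    by exists (n (choice.pickle (i, i))), i, i.
  have : H `<=` G.
    apply: ext; last by rewrite G0.
    split.
    - move=> x y z [i [j [-> -> ->]]]; rewrite !domH.
      by split; [exists i|exists j|exists (choice.pickle (i, j))|exact: nA].
    - move=> x y; rewrite domH => -[i _ <-] [j _ <-].
      by exists (n (choice.pickle (i, j))), i, j.
    - move=> p p' z [i [j [-> ->]]] [i' [j' [->]]].
      by move=> /ninj /(pcan_inj choice.pickleK)[-> ->].
    - right; rewrite domH; apply/infiniteP/card_le_funP.
      by exists n => [i _|i j _ _]; [exists i|exact: ninj].
  rewrite G0 => /(_ ((n 0, n 0), n (choice.pickle (0, 0)))) H0.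
  by exfalso; apply: H0; exists 0, 0.
set X := dom G in Gd Gt Xoo domA.
have XX : X `*` X #<= X.
  apply: (@card_le_rel _ _ _ _ (fun p z => G (p, z))) => // -[x y] [/= Xx Xy].
  by have [z Gz] := Gt _ _ Xx Xy; exists z => //; have [] := Gd _ _ _ Gz.
suff DX : A `\` X #<= X.
  have AX : A #<= X.
    apply: card_le_trans (card_leU Xoo XX (card_lexx X) DX).
    by apply: subset_card_le => x Ax; have [] := pselect (X x); [left|right].
  exact: card_le_trans (card_leX AX AX)
    (card_le_trans XX (subset_card_le domA)).
have [//|/card_le_funP[f fD finj]] := card_le_total (A `\` X) X.
pose Y := f @` X.
have YA y : Y y -> A y /\ ~ X y by move=> [x /fD[? ?] <-].
have YX : Y #<= X by exact: card_image_le.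
have XY : X #<= Y by apply/card_le_funP; exists f => // x Xx; exists x.
have XUY : X `|` Y #<= X by exact: card_leU.
have /card_le_funP[h hY hinj] : (X `|` Y) `*` (X `|` Y) #<= Y.
  exact: card_le_trans (card_leX XUY XUY) (card_le_trans XX XY).
pose H := G `|` [set pz | [/\ (X `|` Y) pz.1.1, (X `|` Y) pz.1.2,
  ~ (X pz.1.1 /\ X pz.1.2) & pz.2 = h pz.1]].
have domH : dom H = X `|` Y.
  apply/seteqP; split=> [x [z [Gxz|[]//]]|x].
    by left; exists z.
  have [[z Gz] _|nXx XYx] := pselect (X x); first by exists z; left.
  by exists (h (x, x)); right; split=> // -[].
have hYp x y : (X `|` Y) x -> (X `|` Y) y -> Y (h (x, y)).
  by move=> ? ?; apply: hY.
have HG : H `<=` G.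
  apply: ext; last by left.
  split; rewrite ?domH.
  - move=> x y z [/Gd[? ? ? ?]|[/= Xx Xy _ ->]]; first by split=> //; left.
    split=> //; first by right; exact: hYp.
    by case: Xx => [/domA|/YA[]].
  - move=> x y Xx Xy; have [[]|nXY] := pselect (X x /\ X y).
      by move=> /Gt/[apply] -[z Gz]; exists z; left.
    by exists (h (x, y)); right.
  - move=> [x y] [x' y'] z [Gz|[/= Xx Xy _ zE]] [Gz'|[/= Xx' Xy' _ zE']].
    + exact: Gi Gz Gz'.
    + have /YA[_] := hYp _ _ Xx' Xy'; rewrite -zE'.
      by have [] := Gd _ _ _ Gz.
    + have /YA[_] := hYp _ _ Xx Xy; rewrite -zE.
      by have [] := Gd _ _ _ Gz'.
    + by apply: hinj; rewrite -?zE ?inE.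
  - by right; apply: sub_infinite_set Xoo; left.
have [x Xx] := infinite_setN0 Xoo.
have Yfx : Y (f x) by exists x.
have [_] := YA _ Yfx; case.
have : dom H (f x) by rewrite domH; right.
exact: domS.
Qed.

(** Iterating a pairing function codes sequences of a given length; pairing
    the result with the length separates sequences of different lengths. *)
Lemma card_seq_le T (A : set T) :
  infinite_set A -> [set s : seq T | forall x, x \in s -> A x] #<= A.
Proof.
move=> Aoo.
have /card_le_funP[c cA cinj] := card_setXX_le Aoo.
have {}cinj x y x' y' : A x -> A y -> A x' -> A y' ->
    c (x, y) = c (x', y') -> x = x' /\ y = y'.
  move=> Ax Ay Ax' Ay' e.
  by have [-> ->] : (x, y) = (x', y') by apply: cinj => //; exact: mem_set.
have /card_le_funP[n nA ninj] := (infiniteP A).1 Aoo.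
have {}ninj i j : n i = n j -> i = j by apply: ninj; exact: mem_set.
pose code (s : seq T) := foldr (fun x z => c (x, z)) (n 0) s.
have codeA s : (forall x, x \in s -> A x) -> A (code s).
  elim: s => [_|x s IH sA] /=; first exact: nA.
  apply: cA; split=> /=; first by apply: sA; rewrite mem_head.
  by apply: IH => y ys; apply: sA; rewrite inE ys orbT.
apply/card_le_funP; exists (fun s => c (n (size s), code s)).
  by move=> s sA; apply: cA; split; [exact: nA|exact: codeA].
move=> s t /set_mem sA /set_mem tA.
move=> /cinj[]; [exact: nA|exact: codeA|exact: nA|exact: codeA|].
move=> /ninj.
elim: s t sA tA => [|x s IH] [|y t] //= sA tA [] eqs.
have sA' z : z \in s -> A z by move=> zs; apply: sA; rewrite inE zs orbT.
have tA' z : z \in t -> A z by move=> zs; apply: tA; rewrite inE zs orbT.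
move=> /cinj[]; [|exact: codeA| |exact: codeA|
  by move=> -> /(IH _ sA' tA' eqs) ->].
- by apply: sA; rewrite mem_head.
- by apply: tA; rewrite mem_head.
Qed.
End CardinalArithmetic.

(** * Sets smaller than the continuum *)

Section BelowTheContinuum.
Implicit Types T U : pointedType.

Lemma card_lt_continuumP T (A : set T) :
  card_lt_continuum A <-> ~ ([set: cantor_space] #<= A).
Proof.
split=> [[Ac Anc] cA|cA].
  by move: Anc; rewrite card_eq_le Ac cA.
have [//|Ac] := card_le_total [set: cantor_space] A.
split=> //; apply/negP => /card_esym; rewrite card_eq_le => /andP[] //.
Qed.

Lemma card_lt_continuum_le T U (A : set T) (B : set U) :
  A #<= B -> card_lt_continuum B -> card_lt_continuum A.
Proof.
move=> AB /card_lt_continuumP Bc; apply/card_lt_continuumP => cA.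
by apply: Bc; exact: card_le_trans AB.
Qed.

Lemma uncountable_cantor_space : ~ countable [set: cantor_space].
Proof.
move=> /card_le_funP[f _ finj].
pose d : cantor_space := fun n =>
  `[< forall x : cantor_space, f x = n -> ~~ x n >].
have dE (x : cantor_space) : x (f x) != d (f x).
  rewrite /d; case: asboolP => [/(_ x erefl)/negbTE->//|].
  move=> /existsNP[y /not_implyP[fy /negP]]; rewrite negbK.
  by move/finj: fy; rewrite !in_setT => /(_ isT isT) -> ->.
by have := dE d; rewrite eqxx.
Qed.

Lemma countable_card_lt_continuum T (A : set T) :
  countable A -> card_lt_continuum A.
Proof.
move=> cA; apply/card_lt_continuumP => /card_le_trans /(_ cA).
exact: uncountable_cantor_space.
Qed.

Lemma card_lt_continuumU T (A B : set T) :
  card_lt_continuum A -> countable B -> card_lt_continuum (A `|` B).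
Proof.
move=> Ac cB; have [fA|Aoo] := pselect (finite_set A).
  apply: countable_card_lt_continuum.
  rewrite -bigcup2E; apply: bigcup_countable => // i _.
  by case: i => [|[|i]] //=; exact: finite_set_countable.
apply: card_lt_continuum_le Ac; apply: card_leU => //.
- exact: card_setXX_le.
- exact: card_le_trans cB ((infiniteP A).1 Aoo).
Qed.

Lemma card_lt_continuum_finI (T : Type) (S : set (set T)) :
  card_lt_continuum S -> card_lt_continuum (finI_from S id).
Proof.
move=> Sc; have [fS|Soo] := pselect (finite_set S).
  apply: countable_card_lt_continuum.
  by apply: finI_from_countable; exact: finite_set_countable.
apply: card_lt_continuum_le Sc; apply: card_le_trans (card_seq_le Soo).
apply: card_le_trans (card_image_le (fun s => \bigcap_(X in [set` s]) X) _).
apply: subset_card_le => _ [D DS <-]; exists (enum_fset D) => //.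
by move=> X /DS /set_mem.
Qed.

End BelowTheContinuum.

(** Take any well-order.  If some initial segment is as large as the whole
    type, transport the order of the least such segment to the type along an
    injection. *)
Lemma wf_initial_segments (T : pointedType) :
  exists lt : T -> T -> Prop,
    [/\ well_founded lt,
        forall x y z, lt x y -> lt y z -> lt x z,
        forall x y, [\/ x = y, lt x y | lt y x] &
        forall x, ~ ([set: T] #<= [set y | lt y x])].
Proof.
have [R Rwo] := well_ordering_principle T.
have Rmin (A : set T) : A !=set0 ->
    exists z, [/\ A z, forall x, A x -> R z x &
      forall y, A y -> (forall x, A x -> R y x) -> y = z].
  move=> [a Aa]; have [|z [[zA zmin] zuniq]] := Rwo [pred x | x \in A].
    by exists a; apply: mem_set.
  exists z; split; first exact: set_mem zA.
    by move=> x Ax; apply: zmin; exact: mem_set.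
  move=> y Ay ymin; symmetry; apply: zuniq.
  by split; [exact: mem_set|move=> x /set_mem/ymin].
have Rxx x : R x x.
  by have [|z [/= -> /(_ x erefl)]] := Rmin [set x]; [exists x|].
have Rtot x y : R x y \/ R y x.
  have [|z [[]/= -> zmin _]] := Rmin [set x; y]; first by exists x; left.
    by left; apply: zmin; right.
  by right; apply: zmin; left.
have Ranti x y : R x y -> R y x -> x = y.
  move=> xy yx; have [|z [_ _ zu]] := Rmin [set x; y]; first by exists x; left.
  have -> : x = z by apply: zu => [|_ [->|->]] //; left.
  by symmetry; apply: zu => [|_ [->|->]] //; right.
pose lt x y := ~ R y x.
have ltW x y : lt x y -> R x y by move=> xy; have [] := Rtot x y.
have ltwf : well_founded lt.
  move=> x; apply: contrapT => nx.
  have [|z [nz zmin _]] := Rmin [set x | ~ Acc lt x]; first by exists x.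
  by apply: nz; constructor=> y zy; apply: contrapT => /zmin.
have lttr x y z : lt x y -> lt y z -> lt x z.
  move=> xy yz zx.
  have [|m [+ mmin _]] := Rmin [set w | [\/ w = x, w = y | w = z]].
    by exists x; constructor 1.
  case=> mE; subst m.
  - have xz : R x z by apply: mmin; constructor 3.
    by have /(Ranti _ _ xz) e := zx; subst z; apply: yz; exact: ltW.
  - by apply: xy; apply: mmin; constructor 1.
  - by apply: yz; apply: mmin; constructor 2.
have lttot x y : [\/ x = y, lt x y | lt y x].
  have [|] := pselect (R y x); last by constructor 2.
  have [|] := pselect (R x y); last by constructor 3.
  by move=> xy yx; constructor 1; exact: Ranti.
have [[x0 Tx0]|noT] :=
  pselect (exists x, [set: T] #<= [set y | lt y x]); last first.
  by exists lt; split=> // x Tx; apply: noT; exists x.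
have [|x [Tx xmin _]] := Rmin [set x | [set: T] #<= [set y | lt y x]].
  by exists x0.
have /card_le_funP[f fx finj] := Tx.
have {}finj a b : f a = f b -> a = b by apply: finj; exact: mem_set.
exists (fun a b => lt (f a) (f b)); split.
- move=> a; have [b ab] : exists b, f a = b by exists (f a).
  elim/(well_founded_ind ltwf): b a ab => b IH a ab.
  by constructor=> c ca; apply: (IH (f c)); rewrite -?ab.
- by move=> a b c; exact: lttr.
- by move=> a b; have [/finj ->||] := lttot (f a) (f b);
    [constructor 1|constructor 2|constructor 3].
- move=> a Ta; have : R x (f a).
    apply: xmin; apply: card_le_trans Ta _; apply/card_le_funP.
    by exists f => // b c _ _; exact: finj.
  exact: fx.
Qed.

(** * Centered families *)

Definition tails : set (set nat) := range (fun m => [set n | m <= n]).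

(** Because of the final segments, the finite intersections of a centered
    family are in fact infinite, and an ultrafilter containing the family and
    the final segments is non-principal. *)
Definition centered (S : set (set nat)) := finI (tails `|` S) id.

Lemma centered0 : centered set0.
Proof.
apply: (@filter_finI _ \oo) => A [[m _ <-]|//].
exact: nbhs_infty_ge.
Qed.

Lemma sub_centered S S' : S `<=` S' -> centered S' -> centered S.
Proof.
move=> SS' S'c D DS; apply: S'c => X /DS /set_mem XS.
by apply/mem_set; case: XS => [|/SS']; [left|right].
Qed.

Lemma centeredU1 S z :
  (forall b, finI_from (tails `|` S) id b -> b `&` z !=set0) ->
  centered (S `|` [set z]).
Proof.
move=> Sz D DS.
have [|n [nb nz]] := Sz (\bigcap_(X in [set` (D `\ z)%fset]) X).
  exists (D `\ z)%fset => // X; rewrite !inE => /andP[Xz /DS].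
  by move=> /set_mem[|[|/= XE]]; [left|right|rewrite XE eqxx in Xz].
exists n => X XD; have [->//|Xz] := eqVneq X z.
by apply: nb; rewrite /= !inE Xz.
Qed.

Lemma centered_chain S :
  (forall D : {fset set nat}, [set` D] `<=` S ->
    exists2 S', centered S' & [set` D] `<=` S') ->
  centered S.
Proof.
move=> Sc D DS.
have [|S' S'c DS'] := Sc [fset X in D | X \in S]%fset.
  by move=> X /=; rewrite !inE => /andP[_ /set_mem].
apply: S'c => X XD; apply/mem_set.
have /set_mem[|XS] := DS _ XD; [by left|right].
by apply: DS'; rewrite /= !inE XD mem_set.
Qed.

(** * The forcing notion *)

Definition supp (x : cantor_space) : set nat := [set n | x n].

Definition agree m (x y : cantor_space) := forall k, k < m -> x k = y k.

Definition crowded (Q : nat -> cantor_space) :=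
  forall i m, exists2 j, Q j <> Q i & agree m (Q i) (Q j).

(** Phrased with initial segments instead of neighbourhoods, so that every
    instance asks for a single term and can be met by a dense set. *)
Definition traps (z : set nat) (Q : nat -> cantor_space) :=
  (exists i, z `<=` supp (Q i)) /\
  forall i m, z `<=` supp (Q i) ->
    exists j, [/\ z `<=` supp (Q j), Q j <> Q i & agree m (Q i) (Q j)].

(** A condition [(H, n)] promises that the terms with index in [H] are trapped
    and that the trapping set is already determined below [n]. *)
Definition condition (Q : nat -> cantor_space) : Type :=
  ({fset nat} * nat)%type.

HB.instance Definition _ Q := Countable.on (condition Q).

Section Forcing.
Variable Q : nat -> cantor_space.
Implicit Types p q r : condition Q.

(** Only the part below [p.2] is final; above it, later terms may still remove
    elements.  The term of index 0 always takes part, which guarantees that some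
    term is trapped. *)
Definition meet p : set nat :=
  [set k | Q 0 k /\ forall i, i \in p.1 -> Q i k].

Definition extends p q := `[< [/\ {subset q.1 <= p.1}, q.2 <= p.2 &
  forall k, k < q.2 -> meet q k -> meet p k] >].

Lemma extendsxx : reflexive extends.
Proof. by move=> p; apply/asboolP; split. Qed.

Lemma extends_anti : antisymmetric extends.
Proof.
move=> [H n] [K m] /andP[/asboolP[/= KH mn _] /asboolP[/= HK nm _]].
congr pair; last by apply/eqP; rewrite eqn_leq mn nm.
by apply/fsetP => i; apply/idP/idP => [/HK|/KH].
Qed.

Lemma extends_trans : transitive extends.
Proof.
move=> q p r /asboolP[qp lqp mqp] /asboolP[rq lrq mrq]; apply/asboolP; split.
- by move=> i /rq /qp.
- exact: leq_trans lqp.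
- move=> k kr /(mrq k kr); apply: mqp; exact: leq_trans lrq.
Qed.

End Forcing.

Arguments meet Q p : clear implicits.

HB.instance Definition _ Q := Order.Le_isPOrder.Build (Order.Disp tt tt)
  (condition Q) (@extendsxx Q) (@extends_anti Q) (@extends_trans Q).

(** If [G] is a generic filter, the trapping set consists of the numbers put
    into it by some condition of [G].  The dense set [hits b] makes it meet
    [b].  The dense set [splits (i, m)] provides a trapped term other than
    [Q i] which agrees with [Q i] up to [m], unless [Q i] is not trapped; a
    condition that does not yet exclude [Q i] can be extended by such a term,
    chosen so close to [Q i] that the part already determined is unaffected. *)
Lemma generic_trap (S : set (set nat)) (Q : nat -> cantor_space) :
  MA_countable -> card_lt_continuum S -> crowded Q ->
  centered (S `|` range (supp \o Q)) ->
  exists2 z, centered (S `|` [set z]) & traps z Q.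
Proof.
move=> MA Sc Qcr cent.
pose B := finI_from (tails `|` (S `|` range (supp \o Q))) id.
have Bmeet b (p : condition Q) : B b -> (b `&` meet Q p) !=set0.
  move=> Bb.
  pose D := ([fset supp (Q i) | i in p.1] `|` [fset supp (Q 0%N)])%fset.
  have : B (b `&` \bigcap_(X in [set` D]) X).
    apply: finI_fromI => //; exists D => // X; rewrite in_fsetU in_fset1 => XD.
    apply/mem_set; right; right.
    by case/orP: XD => [/imfsetP[i _ ->]|/eqP ->]; [exists i|exists 0%N].
  move=> [E ES EE]; have [k] := cent E ES; rewrite [X in X k]EE => -[bk Dk].
  have kD X : X \in D -> X k by move=> XD; exact: Dk.
  exists k; split=> //; split.
    by apply: (kD (supp (Q 0%N))); rewrite in_fsetU in_fset1 eqxx orbT.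
  move=> i ip; apply: (kD (supp (Q i))); rewrite in_fsetU; apply/orP; left.
  by apply/imfsetP; exists i.
pose hits b : set (condition Q) :=
  [set p | exists k, [/\ k < p.2, meet Q p k & b k]].
pose splits (im : nat * nat) : set (condition Q) :=
  [set p | (exists k, [/\ k < p.2, meet Q p k & ~ Q im.1 k]) \/
   exists j, [/\ j \in p.1, Q j <> Q im.1 & agree im.2 (Q im.1) (Q j)]].
have [| | | |G [[p0 Gp0] Gup Gdir] GD] := MA _ (condition Q) _ _
    (hits @` B `|` range splits).
- by exists (fset0, 0%N).
- exact: (@countableP (condition Q)).
- move=> _ [[b Bb <-]|[[i m] _ <-]] p.
    have [k [bk pk]] := Bmeet b p Bb.
    (* raising the bound above k puts k into the trapping set *)
    exists (p.1, maxn p.2 k.+1).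
      by exists k; split=> //=; rewrite leq_max ltnSn orbT.
    by apply/asboolP; split=> //=; rewrite leq_maxl.
  have [pi|/existsNP[k /not_implyP[kp /not_implyP[pk ik]]]] :=
    pselect (forall k, k < p.2 -> meet Q p k -> Q i k); last first.
    by exists p => //; left; exists k.
  have [j ji agr] := Qcr i (maxn p.2 m).
  exists ((j |` p.1)%fset, p.2).
    right; exists j; split; rewrite /= ?inE ?eqxx // => k km.
    by apply: agr; rewrite leq_max km orbT.
  apply/asboolP; split=> //= [x|k kp pk].
    by rewrite !inE => ->; rewrite orbT.
  split; first by case: pk.
  move=> x /=; rewrite !inE => /orP[/eqP ->|xp]; last by case: pk => _; apply.
  by rewrite -agr ?leq_max ?kp //; apply: pi.
- apply: card_lt_continuumU; last first.
    exact: card_le_trans (card_image_le _ _) (countableP _).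
  apply: card_lt_continuum_le (card_image_le hits _) _.
  apply: card_lt_continuum_finI; rewrite setUA; apply: card_lt_continuumU.
    by rewrite setUC; apply: card_lt_continuumU => //; exact: card_image_le.
  exact: card_image_le.
pose z : set nat := [set k | exists2 p, G p & k < p.2 /\ meet Q p k].
have zQ p j : G p -> j \in p.1 -> z `<=` supp (Q j).
  move=> Gp jp k [q Gq [kq qk]].
  have [r [_ /asboolP[pr _ _] /asboolP[_ _ qr]]] := Gdir p q Gp Gq.
  by have [_] := qr k kq qk; apply; exact: pr.
exists z.
  apply: centeredU1 => b Bb.
  have [|p [Gp [k [kp pk bk]]]] := GD (hits b).
    left; exists b => //; case: Bb => D DS <-; exists D => // X /DS /set_mem.
    by rewrite setUA => XS; apply/mem_set; left.
  by exists k; split=> //; exists p.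
split=> [|i m zi].
  by exists 0%N => k [p _ [_ []]].
have [|p [Gp [[k [kp pk []]]|[j [jp ji agr]]]]] := GD (splits (i, m)).
- by right; exists (i, m).
- by apply: zi; exists p.
- by exists j; split=> //; exact: zQ jp.
Qed.

(** * Recursion along the continuum *)

(** If the initial segments of a well-order are small, [generic_trap] can be
    applied at every stage.  Centeredness passes to unions because a finite
    part of the family lies among the sets chosen up to some single stage. *)
Lemma trapping_family (I : pointedType) (Q : I -> nat -> cantor_space)
    (lt : I -> I -> Prop) :
  MA_countable -> well_founded lt ->
  (forall x y z, lt x y -> lt y z -> lt x z) ->
  (forall x y, [\/ x = y, lt x y | lt y x]) ->
  (forall x, card_lt_continuum [set y | lt y x]) ->
  exists z : I -> set nat,
    centered (range z) /\
    forall x, crowded (Q x) ->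
      centered (range z `|` range (supp \o Q x)) -> traps (z x) (Q x).
Proof.
move=> MA ltwf lttr lttot ltc.
pose good x S z := crowded (Q x) ->
  centered (S `|` range (supp \o Q x)) -> traps z (Q x).
have step (x : I) (S : set (set nat)) : exists z,
    card_lt_continuum S -> centered S -> centered (S `|` [set z]) /\ good x S z.
  have [[Sc Scent]|noS] :=
      pselect (card_lt_continuum S /\ centered S); last first.
    by exists set0 => Sc Scent; case: noS.
  have [[Qc QS]|noQ] := pselect
      (crowded (Q x) /\ centered (S `|` range (supp \o Q x))).
    have [z zS zQ] := generic_trap MA Sc Qc QS.
    by exists z => _ _; split=> // _ _.
  (* a stage with nothing to trap contributes the whole of nat *)
  exists setT => _ _; split=> [|Qc QS]; last by case: noQ.
  apply: centeredU1 => b; rewrite setIT; case=> D DS <-.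
  exact: Scent.
have [/= next nextP] := choice (fun xS : I * set (set nat) => step xS.1 xS.2).
pose F x (rec : forall y, lt y x -> set nat) :=
  next (x, [set X | exists y (yx : lt y x), X = rec y yx]).
pose z := Fix ltwf (fun=> set nat) F.
have zE x : z x = next (x, z @` [set y | lt y x]).
  have FE : forall x (f g : forall y, lt y x -> set nat),
      (forall y yx, f y yx = g y yx) -> F x f = F x g.
    move=> {}x f g fg; congr (next (_, _)).
    by apply/seteqP; split=> X [y [yx ->]]; exists y, yx; rewrite fg.
  rewrite /z (Fix_eq ltwf _ _ FE); congr (next (_, _)); apply/seteqP; split=> X.
    by move=> [y [yx ->]]; exists y.
  by move=> [y yx <-]; exists y, yx.
have small x : card_lt_continuum (z @` [set y | lt y x]).
  exact: card_lt_continuum_le (card_image_le _ _) (ltc x).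
have finite_part (A : set I) (D : {fset set nat}) :
    [set` D] `<=` z @` A -> [set` D] = set0 \/
    exists2 x, A x & [set` D] `<=` z @` [set y | lt y x] `|` [set z x].
  rewrite (_ : [set` D] = [set` enum_fset D]) //.
  elim: (enum_fset D) => [|X s IH] sA; first by left; rewrite set_nil.
  right; have [x Ax xX] : (z @` A) X by apply: sA; rewrite /= mem_head.
  have [Y Ys|s0|[y Ay sy]] := IH; first by apply: sA; rewrite /= inE Ys orbT.
    exists x => // Y; rewrite /= inE => /orP[/eqP ->|Ys]; first by right.
    by have : [set` s] Y by []; rewrite s0.
  have [xy|xy|yx] := lttot x y.
  - exists y => // Y; rewrite /= inE => /orP[/eqP ->|/sy //].
    by right; rewrite -xX xy.
  - exists y => // Y; rewrite /= inE => /orP[/eqP ->|/sy //].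
    by left; exists x.
  - exists x => // Y; rewrite /= inE => /orP[/eqP ->|/sy[[w wy <-]|->]].
    + by right.
    + by left; exists w => //; exact: lttr yx.
    + by left; exists y.
have union (A : set I) : (forall y, A y -> centered (z @` [set x | lt x y])) ->
    centered (z @` A).
  move=> Ac; apply: centered_chain => D /finite_part[D0|[x Ax Dx]].
    by exists set0; [exact: centered0|rewrite D0].
  exists (z @` [set y | lt y x] `|` [set z x]) => //.
  rewrite zE.
  by have [] := nextP (x, z @` [set y | lt y x]) (small x) (Ac x Ax).
have cent x : centered (z @` [set y | lt y x]).
  by elim/(well_founded_ind ltwf): x => x IH; exact: union.
exists z; split=> [|x Qc QS]; first exact: union.
rewrite zE; have [_] := nextP (x, z @` [set y | lt y x]) (small x) (cent x).
apply=> //; apply: sub_centered QS; apply: setSU.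
by move=> _ [y _ <-]; exists y.
Qed.

(** * Perfect sets in the Cantor space *)

(** Call a finite binary sequence [s] big if uncountably many elements of [A]
    extend it, and let [W] be the set of the elements of [A] all of whose
    initial segments are big.  Only countably many elements of [A] lie outside
    [W], so every big [s] has many extensions in [W].  Choosing one for each
    big [s] gives a countable set without isolated points. *)
Lemma uncountable_crowded (A : set cantor_space) : ~ countable A ->
  exists2 Q, crowded Q & forall i, A (Q i).
Proof.
move=> Aunc.
pose cyl (s : seq bool) : set cantor_space := [set x | mkseq x (size s) = s].
have cylE m (x : cantor_space) y : cyl (mkseq x m) y -> agree m x y.
  rewrite /cyl /= size_mkseq => e k km.
  by rewrite -(nth_mkseq false x km) -e nth_mkseq.
pose big s := ~ countable (A `&` cyl s).
pose W := [set x | A x /\ forall m, big (mkseq x m)].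
have bigW s a : big s -> exists x, [/\ W x, cyl s x & x <> a].
  move=> sbig; apply: contrapT => noW; apply: sbig.
  have cnt : countable (\bigcup_(t in ~` big) (A `&` cyl t)).
    by apply: bigcup_countable => [|t /contrapT //]; exact: countableP.
  apply: (@sub_countable _ _ _
    ([set a] `|` \bigcup_(t in ~` big) (A `&` cyl t))); last first.
    rewrite -bigcup2E; apply: bigcup_countable => //.
    by move=> [|[|i]] _ //=; exact: countable1.
  apply: subset_card_le => x [Ax xs].
  have [->|xa] := pselect (x = a); [by left|right].
  have [m xm] : exists m, ~ big (mkseq x m).
    apply: contrapT => xbig; apply: noW; exists x; split=> //; split=> // m xm.
    by apply: xbig; exists m; apply.
  by exists (mkseq x m) => //; split; rewrite // /cyl /= size_mkseq.
have big0 : big [::].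
  by rewrite /big (_ : A `&` _ = A) //; apply/seteqP; split=> [x []|].
have /choice[q qP] (s : seq bool) : exists x, big s -> W x /\ cyl s x.
  have [sb|] := pselect (big s); last by exists point.
  by have [x []] := bigW s point sb; exists x.
pose Q n := if choice.unpickle n is Some s
  then if `[< big s >] then q s else q [::] else q [::].
have Qpickle s : big s -> Q (choice.pickle s) = q s.
  by move=> sb; rewrite /Q choice.pickleK; case: asboolP.
have QW n : W (Q n).
  rewrite /Q; case: choice.unpickle => [s|]; last by have [] := qP _ big0.
  by case: asboolP => [/qP[]//|_]; have [] := qP _ big0.
exists Q => [i m|i]; last by have [] := QW i.
have [_ ibig] := QW i; have [w [Ww /cylE iw wi]] := bigW _ (Q i) (ibig m).
have [k wk] : exists k, w k <> Q i k.
  by apply: contrapT => nk; apply: wi; apply/funext => k; apply: contrapT => ?;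
    apply: nk; exists k.
have tbig := Ww.2 (maxn m k.+1); have [_ /cylE wt] := qP _ tbig.
exists (choice.pickle (mkseq w (maxn m k.+1))); rewrite Qpickle //.
  by move=> e; apply: wk; rewrite -e wt // leq_max ltnSn orbT.
by move=> l lm; rewrite iw // wt // leq_max lm.
Qed.

Lemma nbhs_cantorP (x : cantor_space) (U : set cantor_space) :
  nbhs x U <-> exists m, forall y, agree m x y -> U y.
Proof.
split=> [|[m mU]].
  pose F : set_system cantor_space :=
    filter_from [set: nat] (fun m => agree m x).
  have FF : Filter F.
    apply: filter_from_filter; first by exists 0%N.
    move=> i j _ _; exists (maxn i j) => // y xy.
    by split=> k ki; apply: xy; rewrite leq_max ki ?orbT.
  suff : F --> x by move=> /[apply] -[m _ mU]; exists m => y /mU.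
  apply/cvg_sup => i; apply/cvg_image.
    by apply/seteqP; split=> // b _; exists (fun=> b).
  move=> V /principal_filterP Vx.
  exists ((fun f : cantor_space => f i) @^-1` V).
    by exists i.+1 => // y xy /=; rewrite -xy.
  by apply/seteqP; split=> [b [y Vy <-]//|b Vb]; exists (fun=> b).
apply: filterS mU _; elim: m => [|m IH].
  by apply: filterS filterT => y _ k.
have : nbhs x ((fun y : cantor_space => y m) @^-1` [set x m]).
  exact: (@proj_continuous nat (fun=> bool) m x).
move: IH; apply: filterS2 => y xy /= ym k; rewrite ltnS leq_eqVlt.
by move=> /predU1P[->//|]; exact: xy.
Qed.

Lemma perfect_closure (C : set cantor_space) :
  (forall x m, C x -> exists y, [/\ C y, y <> x & agree m x y]) ->
  perfect_set (closure C).
Proof.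
move=> Ccr; split; first exact: closed_closure.
apply/seteqP; split=> [x|x Cx U /nbhs_cantorP[m xU]].
  move=> /subset_limit_point; rewrite -(closure_id (closure C)).1 //.
  exact: closed_closure.
have [|y [Cy xy]] := Cx (agree m x); first by apply/nbhs_cantorP; exists m.
have sub := @subset_closure _ C.
have [yx|/eqP yx] := pselect (y = x); last first.
  by exists y; split=> //; [exact: sub|exact: xU].
have [w [Cw wy yw]] := Ccr y m Cy.
exists w; split; [by apply/eqP; rewrite -yx|exact: sub|apply: xU].
by rewrite -yx.
Qed.

(** * The ultrafilter *)

Theorem corollary31 :
  MA_countable ->
  exists U : set_system nat,
    nonprincipal_ultrafilter U /\
    forall A : set cantor_space,
      closed_subset_of (char_family U) A -> perfect_set_property A.
Proof.
move=> MA.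
(* well-order the Cantor space, whose points code all sequences in it *)
have [lt [ltwf lttr lttot ltc]] := wf_initial_segments cantor_space.
pose Q (x : cantor_space) (i : nat) : cantor_space :=
  fun n => x (choice.pickle (i, n)).
have Qsurj q : exists x, Q x = q.
  exists (fun k => if choice.unpickle k is Some (i, n) then q i n else false).
  by apply/funext => i; apply/funext => n; rewrite /Q choice.pickleK.
have [|z [zcent ztrap]] := @trapping_family _ Q lt MA ltwf lttr lttot.
  by move=> x; apply/card_lt_continuumP.
have [U [Uultra zU]] := ultraFilterLemma (finI_filter zcent).
have UF : ProperFilter U := ultra_proper.
have base X : (tails `|` range z) X -> U X.
  by move=> zX; apply: zU; exists X => //; exact: (@finI_from1 _ _ _ id).
exists U; split.
  split=> // n Un; have : U [set n] by rewrite Un; apply/principal_filterP.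
  have : U [set k | n < k] by apply: base; left; exists n.+1.
  by move=> /filterI/[apply] /filter_ex[k [/= nk kn]]; rewrite kn ltnn in nk.
move=> A [AU /closed_subspaceP[V Vcl VA]].
have AE x : A x <-> V x /\ char_family U x.
  split=> [Ax|VUx]; last first.
    by have [] : (A `&` char_family U) x by rewrite -VA.
  by have : (V `&` char_family U) x by rewrite VA; split=> //; exact: AU.
have charK x : char_fun (supp x) = x.
  by apply/funext => n; apply/idP/idP => [/set_mem|xn]; [|exact/mem_set].
have suppK X : supp (char_fun X) = X.
  by apply/seteqP; split=> n; [move=> /set_mem|move=> Xn; exact/mem_set].
have charU x : char_family U x <-> U (supp x).
  split=> [[X UX <-]|Ux]; first by rewrite suppK.
  by exists (supp x).
have [|Aunc] := pselect (countable A); [by left|right].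
have [q qcr qA] := uncountable_crowded Aunc.
have [x xq] := Qsurj q.
have [||[i0 zi0] zcr] := ztrap x.
- by rewrite xq.
- apply: (@filter_finI _ U) => X.
  move=> [?|[?|[i _ <-]]]; [by apply: base; left|by apply: base; right|].
  by rewrite xq; apply/charU; have /AE[] := qA i.
rewrite xq in zi0 zcr.
pose C := [set q i | i in [set i | z x `<=` supp (q i)]].
exists (closure C); split.
- apply: perfect_closure => _ m [i zi <-].
  by have [j [zj ji agr]] := zcr i m zi; exists (q j); split=> //; exists j.
- by exists (q i0); apply: subset_closure; exists i0.
- move=> p Cp; apply/AE; split.
    apply: Vcl; apply: closureS Cp => _ [i _ <-].
    by have /AE[] := qA i.
  apply/charU; apply: filterS (base (z x) _); last by right; exists x.
  move=> k zk; have [|_ [[i zi <-] pq]] := Cp (agree k.+1 p).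
    by apply/nbhs_cantorP; exists k.+1.
  by rewrite /supp /= pq //; exact: zi.
Qed.
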